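(* There is a predicate formula which is deducible in the calculus $\mathsf{MQC}$ but is not deducible in the classical predicate calculus $\mathsf{CQC}$.
   Context: **Predicate formulas.** $L$ is the first-order language (connectives $\&,\lor,\to,\neg$, quantifiers $\forall,\exists$; no equality, function symbols or constants) whose predicate symbols are predicate variables $P^n_i$ ($n,i\in\mathbb N$; $P^n_i$ has arity $n$). Predicate formulas are formulas of $L$. $\Phi\leftrightarrow\Psi$ abbreviates $(\Phi\to\Psi)\,\&\,(\Psi\to\Phi)$. Write $Z,E,S,A,M$ for $P^1_0,P^2_0,P^2_1,P^3_0,P^3_1$; $P$ and $R$ denote a unary and a binary predicate variable different from these. **The formula $Q$.** Formulas built from $Z,E,S,A,M$ only are called $Ar$-formulas; in the standard model over $\mathbb N$ these symbols mean $x=0$, $x=y$, $x+1=y$, $x+y=z$, $x\cdot y=z$. $x\le y$ abbreviates $\exists z\,A(z,x,y)$. $\Delta_0$-formulas are built from atomic $Ar$-formulas by $\neg,\lor,\&,\to$ and bounded quantifiers $(\exists x\le t),(\forall x\le t)$ ($t\neq x$), i.e. $\exists x(x\le t\,\&\,\cdot)$, $\forall x(x\le t\to\cdot)$; $\Sigma$-formulas are built from $\Delta_0$-formulas by $\lor,\&$, bounded quantifiers and $\exists x$. $\{x\}$ is the unary partial recursive function with Gödel number $x$. $G(x,y,z)$ is a fixed $\Sigma$-formula defining $\{x\}(y)=z$ in the standard model such that intuitionistic (Heyting) arithmetic $\mathsf{HA}$ proves $\forall x,y,z_1,z_2(G(x,y,z_1)\,\&\,G(x,y,z_2)\to z_1=z_2)$.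 $H(x,y)$ is $\exists z(Z(z)\,\&\,G(x,y,z))$. Let $\mathsf c(x,y)=\frac{(x+y)(x+y+1)}2+x$ be the pairing function with projections $\mathsf l,\mathsf r$ ($\mathsf c(\mathsf l(x),\mathsf r(x))=x$), $\mathsf l_*(x,0)=x$, $\mathsf l_*(x,y+1)=\mathsf l(\mathsf l_*(x,y))$, $\mathsf g(x,y)=\mathsf r(\mathsf l_*(x,y))$; $B(u,v)$ is the $Ar$-formula obtained from $\mathsf g(u,v)=1$ by the standard elimination of primitive recursive function symbols via $\Sigma$-formulas provably representing them in $\mathsf{HA}$. $Q$ is the conjunction of: $A_1$: $\forall x,y,z(S(x,z)\,\&\,S(y,z)\to E(x,y))$; $A_2$: $\forall x,y(S(x,y)\to\neg Z(y))$; $A_3$: $\forall x,y,z(E(x,y)\,\&\,E(x,z)\to E(y,z))$; $A_4$: $\forall x,y,z(E(x,y)\,\&\,S(x,z)\to S(y,z))$; $A_5$: $\forall x,y(Z(y)\to A(x,y,x))$; $A_6$: $\forall x,y,z,u,v(S(y,z)\,\&\,A(x,y,u)\,\&\,S(u,v)\to A(x,z,v))$; $A_7$: $\forall x,y(Z(y)\to M(x,y,y))$; $A_8$: $\forall x,y,z,u,v(S(y,z)\,\&\,M(x,y,u)\,\&\,A(u,x,v)\to M(x,z,v))$; $A_9$: $\forall x_1,x_2,y,z(E(x_1,x_2)\,\&\,A(x_1,y,z)\to A(x_2,y,z))$; $A_{10}$: $\forall x,y_1,y_2,z(E(y_1,y_2)\,\&\,A(x,y_1,z)\to A(x,y_2,z))$;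 $A_{11}$: $\forall x_1,x_2,y,z(E(x_1,x_2)\,\&\,M(x_1,y,z)\to M(x_2,y,z))$; $A_{12}$: $\forall x,y_1,y_2,z(E(y_1,y_2)\,\&\,M(x,y_1,z)\to M(x,y_2,z))$; $A_{13}$: $\forall x(Z(x)\lor\exists y\,S(y,x))$; $A_{14}$: $\exists x\,Z(x)$; $A_{15}$: $\forall x,y(Z(x)\,\&\,Z(y)\to E(x,y))$; $A_{16}$: $\forall x,y(E(x,y)\,\&\,Z(x)\to Z(y))$; $A_{17}$: $\forall x\exists y\,S(x,y)$; $A_{18}$: $\forall x,y,z(S(x,y)\,\&\,S(x,z)\to E(y,z))$; $A_{19}$: $\forall x,y,z(S(x,y)\,\&\,E(y,z)\to S(x,z))$; $A_{20}$: $\forall x,y\exists z\,A(x,y,z)$; $A_{21}$: $\forall x,y,z_1,z_2(A(x,y,z_1)\,\&\,A(x,y,z_2)\to E(z_1,z_2))$; $A_{22}$: $\forall x,y,z_1,z_2(A(x,y,z_1)\,\&\,E(z_1,z_2)\to A(x,y,z_2))$; $A_{23}$: $\forall x,y\exists z\,M(x,y,z)$; $A_{24}$: $\forall x,y,z_1,z_2(M(x,y,z_1)\,\&\,M(x,y,z_2)\to E(z_1,z_2))$; $A_{25}$: $\forall x,y,z_1,z_2(M(x,y,z_1)\,\&\,E(z_1,z_2)\to M(x,y,z_2))$; $A_{26}$: $\forall x,y,z_1,z_2(G(x,y,z_1)\,\&\,G(x,y,z_2)\to E(z_1,z_2))$; $A_{27}$: $\forall y,z\,\neg\neg\exists v\forall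 x(x\le z\to(B(v,x)\leftrightarrow H(y,x)))$; $A_{28}$: $\forall x\forall y(B(x,y)\lor\neg B(x,y))$. **The calculus $\mathsf{MQC}$.** The equality axiom for an $n$-ary $P'$ is $\forall\vec x\forall\vec y(E(x_1,y_1)\,\&\dots\&\,E(x_n,y_n)\to(P'(\vec x)\to P'(\vec y)))$; $Eq(E,P_1,\dots,P_m)$ is the conjunction of the equality axioms for $P_1,\dots,P_m$. $M$ (Markov principle) is the formula $\forall x(P(x)\lor\neg P(x))\,\&\,\neg\neg\exists x\,P(x)\to\exists x\,P(x)$. $nCT$ is $\forall x(\neg P(x)\to\exists y\,R(x,y))\to\exists z\forall x(\neg P(x)\to\exists y(G(z,x,y)\,\&\,R(x,y)))$, and $nCT^*$ is the predicate formula $Q\,\&\,Eq(E,P,R)\to nCT$, in which $Z,E,S,A,M$ are treated as predicate variables. A substitutional instance of a formula is obtained by replacing its predicate variables (including $Z,E,S,A,M$) by formulas: each atomic subformula $P_i(v_1,\dots,v_k)$ is replaced by $\Psi_i$ with $v_1,\dots,v_k$ simultaneously substituted for the designated variables $x_1,\dots,x_k$, provided no variable capture occurs. $\mathsf{MQC}$ is the intuitionistic predicate calculus $\mathsf{IQC}$ in the language $L$ with all substitutional instances (by $L$-formulas) of $M$ and $nCT^*$ added as axioms. *)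

(* Defs.v *)
From Stdlib Require List.
From mathcomp Require Import all_boot.

Set Implicit Arguments.
Unset Strict Implicit.
Unset Printing Implicit Defensive.

(* Individual variables are de Bruijn indices (there are no other terms).
   [Pred i xs] is P^n_i(xs) with n = size xs: the arity of a predicate variable
   is read off its argument list, so predicate variables of different arities
   are different even when they share the index i. *)
Inductive formula : Type :=
| Pred of nat & seq nat
| And of formula & formula
| Or of formula & formula
| Imp of formula & formula
| Neg of formula
| All of formula
| Ex of formula.

Declare Scope fm_scope.
Delimit Scope fm_scope with F.
Bind Scope fm_scope with formula.
Notation "p /\ q" := (And p q) : fm_scope.
Notation "p \/ q" := (Or p q) : fm_scope.
Notation "~ p" := (Neg p) : fm_scope.
Notation "p --> q" := (Imp p q) (at level 99, right associativity) : fm_scope.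
Notation "p <-> q" := (And (Imp p q) (Imp q p)) : fm_scope.

Definition up (f : nat -> nat) (k : nat) : nat :=
  if k is k'.+1 then (f k').+1 else 0.

Fixpoint ren (f : nat -> nat) (p : formula) : formula :=
  match p with
  | Pred i xs => Pred i (map f xs)
  | And p q => And (ren f p) (ren f q)
  | Or p q => Or (ren f p) (ren f q)
  | Imp p q => Imp (ren f p) (ren f q)
  | Neg p => Neg (ren f p)
  | All p => All (ren (up f) p)
  | Ex p => Ex (ren (up f) p)
  end.

Definition shift (p : formula) : formula := ren succn p.

Definition inst (p : formula) (y : nat) : formula :=
  ren (fun k => if k is k'.+1 then k' else y) p.

(* p(xs) for a formula p whose free variables are among 0, ..., size xs - 1. *)
Definition fapp (p : formula) (xs : seq nat) : formula := ren (nth 0 xs) p.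

Fixpoint fv_lt (n : nat) (p : formula) : bool :=
  match p with
  | Pred _ xs => all (fun x => x < n) xs
  | And p q | Or p q | Imp p q => fv_lt n p && fv_lt n q
  | Neg p => fv_lt n p
  | All p | Ex p => fv_lt n.+1 p
  end.

(* The formula s n i replaces P^n_i: in it, 0, ..., n-1 are the designated
   variables and n + j is the parameter j.  [psubst_at d] works below d
   quantifiers, where the parameter j is the variable d + j; in particular no
   parameter is ever captured. *)
Fixpoint psubst_at (d : nat) (s : nat -> nat -> formula) (p : formula)
    : formula :=
  match p with
  | Pred i xs =>
      ren (fun k => if k < size xs then nth 0 xs k else d + (k - size xs))
          (s (size xs) i)
  | And p q => And (psubst_at d s p) (psubst_at d s q)
  | Or p q => Or (psubst_at d s p) (psubst_at d s q)
  | Imp p q => Imp (psubst_at d s p) (psubst_at d s q)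
  | Neg p => Neg (psubst_at d s p)
  | All p => All (psubst_at d.+1 s p)
  | Ex p => Ex (psubst_at d.+1 s p)
  end.

Definition psubst (s : nat -> nat -> formula) (p : formula) : formula :=
  psubst_at 0 s p.

(* Kleene's Hilbert-style intuitionistic predicate calculus, extended by the
   axioms Ax.  The axioms may have free variables, and the quantifier rules
   apply to them. *)
Inductive deducible (Ax : formula -> Prop) : formula -> Prop :=
| d_ax p : Ax p -> deducible Ax p
| d_mp p q : deducible Ax (p --> q) -> deducible Ax p -> deducible Ax q
| d_all p q : deducible Ax (shift p --> q) -> deducible Ax (p --> All q)
| d_ex p q : deducible Ax (q --> shift p) -> deducible Ax (Ex q --> p)
| d_k p q : deducible Ax (p --> q --> p)
| d_s p q r : deducible Ax ((p --> q) --> (p --> q --> r) --> p --> r)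
| d_andI p q : deducible Ax (p --> q --> p /\ q)
| d_andl p q : deducible Ax (p /\ q --> p)
| d_andr p q : deducible Ax (p /\ q --> q)
| d_orl p q : deducible Ax (p --> p \/ q)
| d_orr p q : deducible Ax (q --> p \/ q)
| d_orE p q r : deducible Ax ((p --> r) --> (q --> r) --> p \/ q --> r)
| d_negI p q : deducible Ax ((p --> q) --> (p --> ~ q) --> ~ p)
| d_negE p q : deducible Ax (~ p --> p --> q)
| d_allE p y : deducible Ax (All p --> inst p y)
| d_exI p y : deducible Ax (inst p y --> Ex p).

Definition CQC : formula -> Prop :=
  deducible (fun p => exists q : formula, p = (~ ~ q --> q)%F).

Definition aZ (x : nat) : formula := Pred 0 [:: x].
Definition aE (x y : nat) : formula := Pred 0 [:: x; y].
Definition aS (x y : nat) : formula := Pred 1 [:: x; y].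
Definition aA (x y z : nat) : formula := Pred 0 [:: x; y; z].
Definition aM (x y z : nat) : formula := Pred 1 [:: x; y; z].

Definition ar_symbol (n i : nat) : bool :=
  (n, i) \in [:: (1, 0); (2, 0); (2, 1); (3, 0); (3, 1)].

Fixpoint is_Ar (p : formula) : bool :=
  match p with
  | Pred i xs => ar_symbol (size xs) i
  | And p q | Or p q | Imp p q => is_Ar p && is_Ar q
  | Neg p | All p | Ex p => is_Ar p
  end.

Definition aLe (x y : nat) : formula := Ex (aA 0 x.+1 y.+1).

(* The bound t is a variable of the context of the quantifier, hence differs
   from the quantified variable. *)
Definition ball (t : nat) (p : formula) : formula := All (aLe 0 t.+1 --> p).
Definition bex (t : nat) (p : formula) : formula := Ex (aLe 0 t.+1 /\ p).

Inductive Delta0 : formula -> Prop :=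
| D_atom i xs : ar_symbol (size xs) i -> Delta0 (Pred i xs)
| D_neg p : Delta0 p -> Delta0 (~ p)
| D_or p q : Delta0 p -> Delta0 q -> Delta0 (p \/ q)
| D_and p q : Delta0 p -> Delta0 q -> Delta0 (p /\ q)
| D_imp p q : Delta0 p -> Delta0 q -> Delta0 (p --> q)
| D_bex t p : Delta0 p -> Delta0 (bex t p)
| D_ball t p : Delta0 p -> Delta0 (ball t p).

Inductive Sigma : formula -> Prop :=
| S_delta p : Delta0 p -> Sigma p
| S_or p q : Sigma p -> Sigma q -> Sigma (p \/ q)
| S_and p q : Sigma p -> Sigma q -> Sigma (p /\ q)
| S_bex t p : Sigma p -> Sigma (bex t p)
| S_ball t p : Sigma p -> Sigma (ball t p)
| S_ex p : Sigma p -> Sigma (Ex p).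

(* The standard model; only its values on Z, E, S, A, M matter. *)
Definition std (i : nat) (xs : seq nat) : Prop :=
  match i, xs with
  | 0, [:: x] => x = 0
  | 0, [:: x; y] => x = y
  | 1, [:: x; y] => x + 1 = y
  | 0, [:: x; y; z] => x + y = z
  | 1, [:: x; y; z] => x * y = z
  | _, _ => False
  end.

Definition scons (a : nat) (e : nat -> nat) (k : nat) : nat :=
  if k is k'.+1 then e k' else a.

Fixpoint holds (e : nat -> nat) (p : formula) : Prop :=
  match p with
  | Pred i xs => std i (map e xs)
  | And p q => holds e p /\ holds e q
  | Or p q => holds e p \/ holds e q
  | Imp p q => holds e p -> holds e q
  | Neg p => ~ holds e p
  | All p => forall a, holds (scons a e) p
  | Ex p => exists a, holds (scons a e) p
  end.

Inductive rfun : Type :=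
| RZero
| RSucc
| RProj of nat
| RComp of rfun & seq rfun
| RPrec of rfun & rfun
| RMu of rfun.

Inductive reval : rfun -> seq nat -> nat -> Prop :=
| ev_zero xs : reval RZero xs 0
| ev_succ x : reval RSucc [:: x] x.+1
| ev_proj i xs : i < size xs -> reval (RProj i) xs (nth 0 xs i)
| ev_comp f gs xs ys z :
    revals gs xs ys -> reval f ys z -> reval (RComp f gs) xs z
| ev_prec0 f g xs z : reval f xs z -> reval (RPrec f g) (0 :: xs) z
| ev_precS f g n xs y z :
    reval (RPrec f g) (n :: xs) y -> reval g [:: n, y & xs] z ->
    reval (RPrec f g) (n.+1 :: xs) z
| ev_mu f n xs (v : nat -> nat) :
    (forall m, m < n -> reval f (m :: xs) (v m).+1) ->
    reval f (n :: xs) 0 -> reval (RMu f) xs n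
with revals : seq rfun -> seq nat -> seq nat -> Prop :=
| evs_nil xs : revals [::] xs [::]
| evs_cons g gs xs y ys :
    reval g xs y -> revals gs xs ys -> revals (g :: gs) xs (y :: ys).

(* [phi x y z] is {x}(y) = z.  A Goedel numbering of the unary partial recursive
   functions is an acceptable one: the universal function is partial recursive,
   and an index of a partial recursive function can be computed (s-m-n). *)
Definition goedel_numbering (phi : nat -> nat -> nat -> Prop) : Prop :=
  (exists u : rfun, forall x y z, phi x y z <-> reval u [:: x; y] z) /\
  (forall f : rfun, exists s : nat -> nat,
     (exists r : rfun, forall x y, reval r [:: x] y <-> y = s x) /\
     (forall x y z, phi (s x) y z <-> reval f [:: x; y] z)).

(* Quantifier blocks: the body receives the indices of the bound variables,
   which must be shifted by hand below further quantifiers. *)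
Definition all1 (F : nat -> formula) := All (F 0).
Definition all2 (F : nat -> nat -> formula) := All (All (F 1 0)).
Definition all3 (F : nat -> nat -> nat -> formula) := All (All (All (F 2 1 0))).
Definition all4 (F : nat -> nat -> nat -> nat -> formula) :=
  All (All (All (All (F 3 2 1 0)))).
Definition all5 (F : nat -> nat -> nat -> nat -> nat -> formula) :=
  All (All (All (All (All (F 4 3 2 1 0))))).

Local Open Scope fm_scope.

Definition A1 := all3 (fun x y z => aS x z /\ aS y z --> aE x y).
Definition A2 := all2 (fun x y => aS x y --> ~ aZ y).
Definition A3 := all3 (fun x y z => aE x y /\ aE x z --> aE y z).
Definition A4 := all3 (fun x y z => aE x y /\ aS x z --> aS y z).
Definition A5 := all2 (fun x y => aZ y --> aA x y x).
Definition A6 := all5 (fun x y z u v =>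
  aS y z /\ aA x y u /\ aS u v --> aA x z v).
Definition A7 := all2 (fun x y => aZ y --> aM x y y).
Definition A8 := all5 (fun x y z u v =>
  aS y z /\ aM x y u /\ aA u x v --> aM x z v).
Definition A9 := all4 (fun x1 x2 y z => aE x1 x2 /\ aA x1 y z --> aA x2 y z).
Definition A10 := all4 (fun x y1 y2 z => aE y1 y2 /\ aA x y1 z --> aA x y2 z).
Definition A11 := all4 (fun x1 x2 y z => aE x1 x2 /\ aM x1 y z --> aM x2 y z).
Definition A12 := all4 (fun x y1 y2 z => aE y1 y2 /\ aM x y1 z --> aM x y2 z).
Definition A13 := all1 (fun x => aZ x \/ Ex (aS 0 x.+1)).
Definition A14 := Ex (aZ 0).
Definition A15 := all2 (fun x y => aZ x /\ aZ y --> aE x y).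
Definition A16 := all2 (fun x y => aE x y /\ aZ x --> aZ y).
Definition A17 := all1 (fun x => Ex (aS x.+1 0)).
Definition A18 := all3 (fun x y z => aS x y /\ aS x z --> aE y z).
Definition A19 := all3 (fun x y z => aS x y /\ aE y z --> aS x z).
Definition A20 := all2 (fun x y => Ex (aA x.+1 y.+1 0)).
Definition A21 := all4 (fun x y z1 z2 => aA x y z1 /\ aA x y z2 --> aE z1 z2).
Definition A22 := all4 (fun x y z1 z2 => aA x y z1 /\ aE z1 z2 --> aA x y z2).
Definition A23 := all2 (fun x y => Ex (aM x.+1 y.+1 0)).
Definition A24 := all4 (fun x y z1 z2 => aM x y z1 /\ aM x y z2 --> aE z1 z2).
Definition A25 := all4 (fun x y z1 z2 => aM x y z1 /\ aE z1 z2 --> aM x y z2).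

(* G(x,y,z) has the free variables x = 0, y = 1, z = 2; the formulas B(u,v) and
   H(x,y) have the free variables 0 and 1, in this order. *)
Definition Hform (G : formula) : formula := Ex (aZ 0 /\ fapp G [:: 1; 2; 0]).

Definition A26 (G : formula) := all4 (fun x y z1 z2 =>
  fapp G [:: x; y; z1] /\ fapp G [:: x; y; z2] --> aE z1 z2).
Definition A27 (G B : formula) := all2 (fun y z =>
  ~ ~ Ex (All (aLe 0 z.+2 -->
               (fapp B [:: 1; 0] <-> fapp (Hform G) [:: y.+2; 0])))).
Definition A28 (B : formula) := all2 (fun x y =>
  fapp B [:: x; y] \/ ~ fapp B [:: x; y]).

Definition base_axioms : seq formula :=
  [:: A1; A2; A3; A4; A5; A6; A7; A8; A9; A10; A11; A12; A13; A14; A15; A16;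
      A17; A18; A19; A20; A21; A22; A23; A24; A25].

Fixpoint bigAnd (p : formula) (ps : seq formula) : formula :=
  if ps is q :: qs then p /\ bigAnd q qs else p.

Definition Q (G B : formula) : formula :=
  bigAnd A1 (behead base_axioms ++ [:: A26 G; A27 G B; A28 B]).

(* Induction on the variable 0 of p; the variables k.+1 are parameters. *)
Definition induction (p : formula) : formula :=
  All (aZ 0 --> p) /\
  All (All (aS 1 0 /\ ren succn p --> ren (up succn) p)) --> All p.

(* HA in the relational language: A1-A25 comprise the equality axioms, the
   totality and functionality of S, A, M, and the recursion equations. *)
Inductive HA_axiom : formula -> Prop :=
| HA_base p : List.In p base_axioms -> HA_axiom p
| HA_ind p : is_Ar p -> HA_axiom (induction p).

Definition HA : formula -> Prop := deducible HA_axiom.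

(* F(x,w) resp. F(x,y,w) is the graph of a function with value w, provably
   in HA. *)
Definition fun1 (F : formula) : Prop :=
  [/\ Sigma F, fv_lt 2 F,
      HA (all1 (fun x => Ex (fapp F [:: x.+1; 0]))) &
      HA (all3 (fun x w1 w2 =>
            fapp F [:: x; w1] /\ fapp F [:: x; w2] --> aE w1 w2))].

Definition fun2 (F : formula) : Prop :=
  [/\ Sigma F, fv_lt 3 F,
      HA (all2 (fun x y => Ex (fapp F [:: x.+1; y.+1; 0]))) &
      HA (all4 (fun x y w1 w2 =>
            fapp F [:: x; y; w1] /\ fapp F [:: x; y; w2] --> aE w1 w2))].

(* c, l, r, ls, g represent the functions of the same names (ls is l_star):
   HA proves their defining equations, where the equation for c is taken in
   the division-free form w + w = (x+y)(x+y+1) + (x+x). *)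
Record represents (c l r ls g : formula) : Prop := Represents {
  rep_c : fun2 c;
  rep_l : fun1 l;
  rep_r : fun1 r;
  rep_ls : fun2 ls;
  rep_g : fun2 g;
  rep_cE : HA (all3 (fun x y w => all5 (fun s t p d e =>
    fapp c [:: x + 5; y + 5; w + 5] /\
    aA (x + 5) (y + 5) s /\ aS s t /\ aM s t p /\
    aA (x + 5) (x + 5) d /\ aA p d e --> aA (w + 5) (w + 5) e)));
  rep_lrE : HA (all3 (fun x a b =>
    fapp l [:: x; a] /\ fapp r [:: x; b] --> fapp c [:: a; b; x]));
  rep_ls0 : HA (all2 (fun x y => aZ y --> fapp ls [:: x; y; x]));
  rep_lsS : HA (all5 (fun x y y' p q =>
    aS y y' /\ fapp ls [:: x; y; p] /\ fapp l [:: p; q] -->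
    fapp ls [:: x; y'; q]));
  rep_gE : HA (all4 (fun x y p q =>
    fapp ls [:: x; y; p] /\ fapp r [:: p; q] --> fapp g [:: x; y; q]))
}.

(* g(u,v) = 1 with u = 0, v = 1, where g is the formula representing g. *)
Definition Bform (g : formula) : formula :=
  Ex (fapp g [:: 1; 2; 0] /\ Ex (aZ 0 /\ aS 0 1)).

Definition aP (x : nat) : formula := Pred 1 [:: x].
Definition aR (x y : nat) : formula := Pred 2 [:: x; y].

Definition Markov : formula :=
  All (aP 0 \/ ~ aP 0) /\ ~ ~ Ex (aP 0) --> Ex (aP 0).

Definition EqPR : formula :=
  all2 (fun x y => aE x y --> aP x --> aP y) /\
  all4 (fun x1 x2 y1 y2 => aE x1 y1 /\ aE x2 y2 --> aR x1 x2 --> aR y1 y2).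

Definition nCT (G : formula) : formula :=
  All (~ aP 0 --> Ex (aR 1 0)) -->
  Ex (All (~ aP 0 --> Ex (fapp G [:: 2; 1; 0] /\ aR 1 0))).

Definition nCTstar (G B : formula) : formula := Q G B /\ EqPR --> nCT G.

Inductive MQC_axiom (G B : formula) : formula -> Prop :=
| MQC_Markov s : MQC_axiom G B (psubst s Markov)
| MQC_nCT s : MQC_axiom G B (psubst s (nCTstar G B)).

Definition MQC (G B : formula) : formula -> Prop := deducible (MQC_axiom G B).

(* Main.v *)
Require Import Defs.
From mathcomp Require Import all_boot zify.
From Stdlib Require Import Classical.

Set Implicit Arguments.
Unset Strict Implicit.
Unset Printing Implicit Defensive.

(** Extended Church's thesis is classically false, and one substitutional instance
    of [nCTstar] suffices to say so.  Leave [Z], [E], [S], [A], [M] and [P] as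
    they are and replace [R(x, y)] by [~ G(x, x, y)].  The result is an axiom of
    [MQC]; it is false in the standard model, and by classical soundness it is
    therefore not deducible in [CQC].

    To see that it is false ([nCT_instance_false]), note that the model
    interprets [P] as the empty predicate, so that [nCT] reads: if every [x] has
    a [y] with not [{x}(x) = y], then some [z] is such that for every [x],
    [{z}(x)] is defined and differs from [{x}(x)].  As [{x}(x)] has at most one
    value, [0] or [1] is a suitable [y]; but at [x = z] the conclusion is absurd.

    The equality axioms for [P] and [R] hold because [E] is interpreted as
    equality.  It remains to see that [Q] is true in the standard model
    ([Q_true]).  The theorems of [HA] are true there ([HA_sound]), which gives
    [A1], ..., [A25] and [A26 G], and [A28] is an instance of excluded middle.
    [A27] holds classically because every finite
    sequence of truth values is coded by some number [v] through [g(v, x) = 1]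
    ([g_bit_sequences]).  This follows from the equations that [HA] proves about
    the pairing function and its projections: as the graphs involved are
    only known through these equations, the argument is relational. *)

(** * Truth under renaming *)

Lemma holds_ren p : forall f e e', (forall k, e (f k) = e' k) ->
  holds e (ren f p) <-> holds e' p.
Proof.
have up_scons f e e' a : (forall k, e (f k) = e' k) ->
    forall k, scons a e (up f k) = scons a e' k by move=> E [|k] /=.
elim: p => /= [i xs|p IHp q IHq|p IHp q IHq|p IHp q IHq|p IHp|p IHp|p IHp]
  f e e' E; try by have [? ?] := IHp _ _ _ E; try have [? ?] := IHq _ _ _ E;
  tauto.
- by rewrite -map_comp (eq_map E).
- by split=> H a; apply/(IHp _ _ _ (up_scons f e e' a E)).
- by split=> -[a H]; exists a; apply/(IHp _ _ _ (up_scons f e e' a E)).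
Qed.

Lemma holds_ren_comp p f e : holds e (ren f p) <-> holds (e \o f) p.
Proof. exact: holds_ren. Qed.

Lemma holds_fv p : forall n e e', fv_lt n p -> (forall k, k < n -> e k = e' k) ->
  holds e p <-> holds e' p.
Proof.
have scons_lt n e e' a : (forall k, k < n -> e k = e' k) ->
    forall k, k < n.+1 -> scons a e k = scons a e' k.
  by move=> E [|k] //= /E.
elim: p => /= [i xs|p IHp q IHq|p IHp q IHq|p IHp q IHq|p IHp|p IHp|p IHp]
  n e e'.
- move=> /allP lt_xs E.
  by have -> : map e xs = map e' xs by apply/eq_in_map => x /lt_xs /E.
- by move=> /andP[np nq] E; rewrite (IHp _ _ _ np E) (IHq _ _ _ nq E).
- by move=> /andP[np nq] E; rewrite (IHp _ _ _ np E) (IHq _ _ _ nq E).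
- by move=> /andP[np nq] E; rewrite (IHp _ _ _ np E) (IHq _ _ _ nq E).
- by move=> np E; rewrite (IHp _ _ _ np E).
- by move=> np E; split=> H a; apply/(IHp _ _ _ np (scons_lt n e e' a E)).
- by move=> np E; split=> -[a H]; exists a;
    apply/(IHp _ _ _ np (scons_lt n e e' a E)).
Qed.

Lemma holds_fapp p xs e : fv_lt (size xs) p ->
  holds e (fapp p xs) <-> holds (nth 0 (map e xs)) p.
Proof.
move=> lt_p; rewrite (@holds_ren _ _ _ (fun k => e (nth 0 xs k))) //.
by apply: (holds_fv lt_p) => k lt_k; rewrite (nth_map 0).
Qed.

Lemma holds_shift p e a : holds (scons a e) (shift p) <-> holds e p.
Proof. exact: holds_ren. Qed.

Lemma holds_inst p y e : holds e (inst p y) <-> holds (scons (e y) e) p.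
Proof. by apply: holds_ren => -[]. Qed.

(** * Soundness for the standard model *)

Lemma soundness Ax p : (forall q e, Ax q -> holds e q) ->
  deducible Ax p -> forall e, holds e p.
Proof.
move=> Ax_true; elim=> {p} /=; try by move=> *; tauto.
- by move=> p /Ax_true H e; apply: H.
- by move=> p q _ IHpq _ IHp e; apply: IHpq.
- by move=> p q _ IH e Hp a; apply: IH; apply/holds_shift.
- by move=> p q _ IH e [a Hq]; apply/(holds_shift p e a)/IH.
- by move=> p y e Hp; apply/holds_inst.
- by move=> p y e /holds_inst Hp; exists (e y).
Qed.

Lemma CQC_sound p : CQC p -> forall e, holds e p.
Proof. by apply: soundness => _ e [q ->] /= /NNPP. Qed.

Lemma base_axioms_true p : List.In p base_axioms -> forall e, holds e p.
Proof.
move=> Hp e; repeat (case: Hp => [<-|Hp]) => //=; try by intuition lia.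
- by move=> [|x]; [left|right; exists x; rewrite addn1].
- by exists 0.
- by move=> x; exists (x + 1).
- by move=> x y; exists (x + y).
- by move=> x y; exists (x * y).
Qed.

Lemma HA_sound p : HA p -> forall e, holds e p.
Proof.
apply: soundness => {}p e [{}p /base_axioms_true //|{}p _] /= [H0 IH].
elim=> [|n IHn]; first exact: H0.
have up_env k : scons n.+1 (scons n e) (up succn k) = scons n.+1 e k by case: k.
apply/(holds_ren p up_env)/IH; rewrite addn1; split=> //.
exact/holds_shift.
Qed.

(** * Substitution for R alone *)

Lemma Sigma_Ar p : Sigma p -> is_Ar p.
Proof.
have Delta0_Ar q : Delta0 q -> is_Ar q.
  by elim=> //= q1 q2 _ -> _ ->.
by elim=> //= q1 q2 _ -> _ ->.
Qed.

Lemma is_Ar_ren f p : is_Ar (ren f p) = is_Ar p.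
Proof.
elim: p f => //= [i xs|p IHp q IHq|p IHp q IHq|p IHp q IHq] f.
- by rewrite size_map.
all: by rewrite IHp IHq.
Qed.

Lemma is_Ar_Bform g : is_Ar g -> is_Ar (Bform g).
Proof. by rewrite /= is_Ar_ren => ->. Qed.

Lemma is_Ar_Q G B : is_Ar G -> is_Ar B -> is_Ar (Q G B).
Proof. by move=> ArG ArB; rewrite /= !is_Ar_ren ArG ArB. Qed.

(** In the formula put for [P^n_i] the designated variables are [0, ..., n-1], so
    [Pred i (iota 0 n)] leaves the symbol as it is. *)
Definition replaceR (F : formula) (n i : nat) : formula :=
  if (n, i) == (2, 2) then F else Pred i (iota 0 n).

Lemma psubst_Ar F d p : is_Ar p -> psubst_at d (replaceR F) p = p.
Proof.
elim: p d => /= [i xs|p IHp q IHq|p IHp q IHq|p IHp q IHq|p IHp|p IHp|p IHp] d;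
  try by move=> /andP[/IHp-> /IHq->].
- rewrite /replaceR => Ar_xs; case: eqP => [sz_xs|_].
    by move: Ar_xs; rewrite /ar_symbol sz_xs.
  congr Pred; apply: (@eq_from_nth _ 0); rewrite size_map size_iota // => k lt_k.
  by rewrite (nth_map 0) ?size_iota // nth_iota // add0n lt_k.
all: by move=> /IHp->.
Qed.

(** * Coding of finite sequences *)

(** The number [s (s + 1) + 2 x] with [x <= s] lies below [(s + 1) (s + 2)], so
    it determines [s = x + y], and then [x]. *)
Lemma cantor_inj x y x' y' :
  (x + y) * (x + y + 1) + (x + x) = (x' + y') * (x' + y' + 1) + (x' + x') ->
  x = x' /\ y = y'.
Proof.
move=> E; suff: x + y = x' + y' by nia.
by case: (ltngtP (x + y) (x' + y')) => // ?; nia.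
Qed.

(** Here [C], [L], [Rr], [Ls], [Gg] are graphs satisfying the defining equations of
    c, l, r, l_*, g.  A code of [D 0, ..., D n] is the pair of a code of
    [D 1, ..., D n] and of the truth value of [D 0]: since l_* iterates l, one has
    l_*(v, x + 1) = l_*(l(v), x), and so g(v, x + 1) = g(l(v), x). *)
Lemma bit_sequences (C Ls Gg : nat -> nat -> nat -> Prop) (L Rr : nat -> nat -> Prop) :
  (forall x y, exists w, C x y w) ->
  (forall x y w, C x y w -> w + w = (x + y) * (x + y + 1) + (x + x)) ->
  (forall x, exists a, L x a) -> (forall x, exists b, Rr x b) ->
  (forall x a b, L x a -> Rr x b -> C a b x) ->
  (forall x y, exists p, Ls x y p) ->
  (forall x y p p', Ls x y p -> Ls x y p' -> p = p') ->
  (forall x, Ls x 0 x) ->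
  (forall x y p q, Ls x y p -> L p q -> Ls x y.+1 q) ->
  (forall x y q q', Gg x y q -> Gg x y q' -> q = q') ->
  (forall x y p q, Ls x y p -> Rr p q -> Gg x y q) ->
  forall n (D : nat -> Prop), exists v, forall x, x < n -> Gg v x 1 <-> D x.
Proof.
move=> C_tot CE L_tot R_tot LRE Ls_tot Ls_fun Ls0 LsS G_fun GE.
have unpair a b w : C a b w -> L w a /\ Rr w b.
  move=> Cw; have [[a' La] [b' Rb]] := (L_tot w, R_tot w).
  have Cw' := LRE _ _ _ La Rb.
  by have [-> ->] : a = a' /\ b = b' by apply: cantor_inj; rewrite -!(CE _ _ w).
have Ls_tail v v' x p : L v v' -> Ls v' x p -> Ls v x.+1 p.
  move=> Lv; elim: x p => [|x IHx] p Lsp.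
    by rewrite (Ls_fun _ _ _ _ Lsp (Ls0 v')); apply: LsS Lv.
  have [q Lsq] := Ls_tot v' x; have [q' Lq] := L_tot q.
  rewrite (Ls_fun _ _ _ _ Lsp (LsS _ _ _ _ Lsq Lq)).
  exact: LsS (IHx _ Lsq) Lq.
have G_tail v v' x : L v v' -> Gg v x.+1 1 <-> Gg v' x 1.
  move=> Lv; have [p Lsp] := Ls_tot v' x; have [q Rq] := R_tot p.
  have Gq := GE _ _ _ _ Lsp Rq; have Gq' := GE _ _ _ _ (Ls_tail _ _ _ _ Lv Lsp) Rq.
  by split=> [/(G_fun _ _ _ _ Gq') E|/(G_fun _ _ _ _ Gq) E]; rewrite -E.
elim=> [|n IHn] D; first by exists 0.
have [v' Hv'] := IHn (fun x => D x.+1).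
have [b Hb] : exists b, b = 1 <-> D 0.
  by have [D0|nD0] := classic (D 0); [exists 1|exists 0].
have [v /unpair[Lv Rv]] := C_tot v' b.
exists v => -[_|x lt_x]; last by rewrite (G_tail _ _ _ Lv); apply: Hv'.
have Gb := GE _ _ _ _ (Ls0 v) Rv.
by rewrite -Hb; split=> [/(G_fun _ _ _ _ Gb)|<-].
Qed.

Definition rel1 p a b := holds (nth 0 [:: a; b]) p.
Definition rel2 p a b c := holds (nth 0 [:: a; b; c]) p.

Lemma fun1_graph F : fun1 F -> fv_lt 2 F /\
  (forall x, exists w, rel1 F x w).
Proof.
case=> _ fvF /HA_sound tot _; split=> // x.
have /= /(_ x)[w Hw] := tot (fun=> 0); exists w.
by move: Hw; rewrite holds_fapp.
Qed.

Lemma HA_functional F : fv_lt 3 F -> HA (A26 F) ->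
  forall x y w w', rel2 F x y w -> rel2 F x y w' -> w = w'.
Proof.
move=> fvF /HA_sound func x y w w' Fw Fw'.
by have /= /(_ x y w w') := func (fun=> 0); rewrite !holds_fapp //; apply.
Qed.

Lemma fun2_graph F : fun2 F -> [/\ fv_lt 3 F,
  forall x y, exists w, rel2 F x y w &
  forall x y w w', rel2 F x y w -> rel2 F x y w' -> w = w'].
Proof.
case=> _ fvF /HA_sound tot func; split=> // [x y|]; last exact: HA_functional.
have /= /(_ x y)[w Hw] := tot (fun=> 0); exists w.
by move: Hw; rewrite holds_fapp.
Qed.

Lemma g_bit_sequences c l r ls g : represents c l r ls g ->
  forall n (D : nat -> Prop), exists v, forall x, x < n -> rel2 g v x 1 <-> D x.
Proof.
case=> /fun2_graph[fvc c_tot _] /fun1_graph[fvl l_tot] /fun1_graph[fvr r_tot].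
case/fun2_graph=> fvls ls_tot ls_fun /fun2_graph[fvg _ g_fun].
move=> /HA_sound cE /HA_sound lrE /HA_sound ls0 /HA_sound lsS /HA_sound gE.
pose e0 := fun _ : nat => 0.
apply: (bit_sequences c_tot _ l_tot r_tot _ ls_tot ls_fun _ _ g_fun) =>
    [x y w cw|x a b la rb|x|x y p q lsp lq|x y p q lsp rq].
- have /= := cE e0.
  move=> /(_ x y w (x + y) (x + y + 1) ((x + y) * (x + y + 1)) (x + x)).
  by move=> /(_ ((x + y) * (x + y + 1) + (x + x))); rewrite holds_fapp //; apply.
- by have /= /(_ x a b) := lrE e0; rewrite !holds_fapp //; apply.
- by have /= /(_ x 0) := ls0 e0; rewrite holds_fapp //; apply.
- by have /= /(_ x y y.+1 p q) := lsS e0; rewrite addn1 !holds_fapp //; apply.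
- by have /= /(_ x y p q) := gE e0; rewrite !holds_fapp //; apply.
Qed.

(** * The standard model satisfies Q *)

Lemma holds_Bform g e : fv_lt 3 g -> holds e (Bform g) <-> rel2 g (e 0) (e 1) 1.
Proof.
move=> fvg /=; split=> [[w [gw [z [z0 zw]]]]|gw].
  by move: gw; rewrite holds_fapp //= -zw z0.
by exists 1; rewrite holds_fapp //; split=> //; exists 0.
Qed.

Lemma Q_true G c l r ls g e : HA (A26 G) -> represents c l r ls g ->
  holds e (Q G (Bform g)).
Proof.
move=> /HA_sound G_fun rep.
have [fvg _ _] := fun2_graph (rep_g rep).
have A27_true : holds e (A27 G (Bform g)).
  move=> y z; apply.
  (* D x says that {y}(x) = 0. *)
  pose D x := holds (fun k => if k is 0 then y else x) (Hform G).
  have [v Hv] := g_bit_sequences rep z.+1 D.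
  exists v => x [w /= le_xz].
  set e' := scons x _.
  have B_x : holds e' (fapp (Bform g) [:: 1; 0]) <-> D x.
    rewrite -Hv; last by lia.
    by rewrite /fapp holds_ren_comp; apply: holds_Bform.
  have H_x : holds e' (fapp (Hform G) [:: 3; 0]) <-> D x.
    by apply: holds_ren => -[|[|[|k]]].
  by split=> [/B_x/H_x|/H_x/B_x].
have A28_true : holds e (A28 (Bform g)) by move=> x y; apply: classic.
have A_true p : List.In p base_axioms -> holds e p by move=> /base_axioms_true.
do 25!(split; first by apply: A_true; do 25?[by left|right]).
by split; [exact: G_fun|split].
Qed.

(** * The diagonal instance of nCT *)

(** Put for [R(x, y)], so the variables [0] and [1] are [x] and [y]. *)
Definition off_diagonal (G : formula) : formula := Neg (fapp G [:: 0; 0; 1]).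

(** Classically every [x] has a [y] with not [{x}(x) = y], but an index [z] of a
    function choosing such values would satisfy both [{z}(z) = y] and not
    [{z}(z) = y] for some [y]. *)
Lemma nCT_instance_false G c l r ls g e :
  Sigma G -> fv_lt 3 G -> HA (A26 G) -> represents c l r ls g ->
  ~ holds e (psubst (replaceR (off_diagonal G)) (nCTstar G (Bform g))).
Proof.
move=> Sigma_G fvG G_fun rep nCT_true.
set s := replaceR _ in nCT_true.
have Sigma_g : Sigma g by case: (rep_g rep).
have Q_holds : holds e (psubst_at 0 s (Q G (Bform g))).
  rewrite psubst_Ar; first exact: Q_true rep.
  by rewrite is_Ar_Q ?is_Ar_Bform ?Sigma_Ar.
have R_holds d x y e' :
    holds e' (psubst_at d s (aR x y)) <-> ~ rel2 G (e' x) (e' x) (e' y).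
  pose f k := if k < 2 then nth 0 [:: x; y] k else d + (k - 2).
  rewrite [holds _ _](_ : _ = ~ holds e' (ren f (fapp G [:: 0; 0; 1]))) //.
  by rewrite holds_ren_comp holds_fapp.
have [||z /(_ z)[|y [Gzzy]]] := nCT_true _ _.
- split=> //; split; first by [].
  move=> x1 x2 y1 y2 [/= E1 E2] /R_holds nG; apply/R_holds.
  by move: nG; rewrite /= E1 E2.
- (* Of two distinct candidates, at most one is the value of {x} at x. *)
  move=> x _; have [G0|nG0] := classic (rel2 G x x 0).
    by exists 1; apply/R_holds => /= /(HA_functional fvG G_fun G0).
  by exists 0; apply/R_holds.
- by [].
move=> /R_holds; apply.
have : holds (scons y (scons z (scons z e))) (psubst_at 3 s (fapp G [:: 2; 1; 0])).
  exact: Gzzy.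
by rewrite psubst_Ar ?is_Ar_ren ?Sigma_Ar // holds_fapp.
Qed.

Theorem theorem5p5 (phi : nat -> nat -> nat -> Prop) (G c l r ls g : formula)
    (hphi : goedel_numbering phi)
    (hG_Sigma : Sigma G)
    (hG_fv : fv_lt 3 G)
    (hG_def : forall e : nat -> nat, holds e G <-> phi (e 0) (e 1) (e 2))
    (hG_fun : HA (A26 G))
    (hrep : represents c l r ls g) :
  exists Phi : formula, MQC G (Bform g) Phi /\ ~ CQC Phi.
Proof.
exists (psubst (replaceR (off_diagonal G)) (nCTstar G (Bform g))); split.
  exact/d_ax/MQC_nCT.
by move=> /CQC_sound/(_ (fun=> 0)); apply: nCT_instance_false hrep.
Qed.
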